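(* Let $m,r\ge 1$ be integers with $m\ge r$, and let $\mathsf{H}^{(r)}_m$ denote the $r$-th derivative of the shifted Horadam polynomial $\mathsf{H}_m$. Then for all real $x$ $$\mathsf{H}^{(r)}_{m}(x)=-\frac{1}{2\sqrt{\pi}}\sum_{p=0}^{m-r}\frac{(1+2m-p)!\,\Gamma\left(-\frac12-m+p\right)(m-p)!}{(m-p)!\,p!\,(m-p-r)!}\,x^{m-p-r},$$ and for all real $x\neq 0$ $$\mathsf{H}^{(r)}_{m}(x)=-\frac{\Gamma\left(-m-\frac12\right)\Gamma(2m+2)}{2\sqrt{\pi}\,\Gamma(m-r+1)}\;{}_2F_1\left(-m-\tfrac12,\,r-m;\,-2m-1;\,\tfrac1x\right)x^{m-r}.$$
   Context: The shifted Horadam polynomials $\mathsf{H}_m(x)$, $m=0,1,2,\dots$, are defined by $\mathsf{H}_0(x)=1$, $\mathsf{H}_1(x)=-2(2x-1)$, and $\mathsf{H}_m(x)=-2(2x-1)\mathsf{H}_{m-1}(x)-\mathsf{H}_{m-2}(x)$ for $m\ge 2$. $\Gamma$ is the Gamma function. Write $(a)_p=a(a+1)\cdots(a+p-1)$, $(a)_0=1$. For a nonnegative integer $k$, ${}_2F_1(b,-k;c;z)$ denotes the terminating hypergeometric polynomial $\sum_{p=0}^{k}(-1)^p\binom{k}{p}\frac{(b)_p}{(c)_p}z^p$; here $k=m-r$, $b=-m-\frac12$, $c=-2m-1$, and $(c)_p\ne 0$ for $0\le p\le m-r$. *)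

(* Defs.v *)
From mathcomp Require Import all_boot all_order all_algebra.
From mathcomp Require Import all_classical all_reals all_analysis.

Set Implicit Arguments.
Unset Strict Implicit.
Unset Printing Implicit Defensive.
Import Order.TTheory GRing.Theory Num.Theory.
Local Open Scope ring_scope.

Fixpoint horadam (R : realType) (m : nat) : {poly R} :=
  match m with
  | 0%N => 1
  | m1.+1 =>
      match m1 with
      | 0%N => - 2 *: (2 *: 'X - 1)
      | m2.+1 => (- 2 *: (2 *: 'X - 1)) * horadam R m1 - horadam R m2
      end
  end.

(* The rising factorial a (a + 1) ... (a + p - 1). *)
Definition poch (R : realType) (a : R) (p : nat) : R :=
  \prod_(i < p) (a + i%:R).

(* Euler's integral; meaningful only for 0 < x. *)
Definition euler_gamma (R : realType) (x : R) : R :=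
  Rintegral (@lebesgue_measure R) (`]0, +oo[%classic : set R)
    (fun t : R => t `^ (x - 1) * expR (- t)).

(* Gamma on the real line: Euler's integral for 0 < x, extended to x <= 0 by
   Gamma (x + n) = x (x + 1) ... (x + n - 1) * Gamma x, where n is the least
   natural number such that 0 < x + n. At the poles 0, -1, -2, ... the
   denominator vanishes and the value is 0 by convention. *)
Definition Gamma (R : realType) (x : R) : R :=
  let n := if 0 < x then 0%N else (Num.truncn (- x)).+1 in
  euler_gamma (x + n%:R) / poch x n.

(* The terminating series 2F1(b, -k; c; z); the natural number k stands for
   the second parameter -k. *)
Definition hyp2F1_term (R : realType) (b : R) (k : nat) (c z : R) : R :=
  \sum_(0 <= p < k.+1)
    (- 1) ^+ p * 'C(k, p)%:R * (poch b p / poch c p) * z ^+ p.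

(* Main.v *)
(* H_m(x) = U_m(1 - 2x) with U_m the Chebyshev polynomial of the second kind,
   so the coefficient of x^k is (-4)^k C(m+k+1, 2k+1), by Pascal's rule. Both
   formulas then reduce termwise to the value of Gamma at -1/2 - k, a rational
   multiple of Gamma(1/2) = sqrt pi, which is the Gauss integral after the
   substitution t = u^2. *)
Require Import Defs.
From mathcomp Require Import all_boot all_order all_algebra.
From mathcomp Require Import all_classical all_reals all_analysis.
From mathcomp Require Import measurable_realfun.
From mathcomp Require Import ring lra zify.

Set Implicit Arguments.
Unset Strict Implicit.
Unset Printing Implicit Defensive.
Import Order.TTheory GRing.Theory Num.Theory.
Local Open Scope ring_scope.

(** * Coefficients of the shifted Horadam polynomials and of their derivatives *)

Lemma coef_horadam (R : realType) (m k : nat) :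
  (horadam R m)`_k = (- 4) ^+ k * 'C(m + k + 1, 2 * k + 1)%:R.
Proof.
(* The recurrence has order two, so the induction carries two consecutive indices, for all [k] at
   once. *)
suff : forall k, (horadam R m)`_k = (- 4) ^+ k * 'C(m + k + 1, 2 * k + 1)%:R /\
   (horadam R m.+1)`_k = (- 4) ^+ k * 'C(m.+1 + k + 1, 2 * k + 1)%:R.
  by move=> /(_ k)[].
elim: m {k} => [|m IH] k.
  split.
    rewrite /= coef1; case: k => [|k]; first by rewrite expr0 mul1r.
    by rewrite bin_small ?mulr0//; lia.
  rewrite /= !(coefZ, coefB, coefX, coef1).
  case: k => [|[|k]] /=.
  - rewrite expr0 mul1r !addn0 bin1; ring.
  - by rewrite expr1 binn; ring.
  - by rewrite bin_small; [ring|lia].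
split; first exact: (IH k).2.
have -> : horadam R m.+2 =
  - 2 *: (2 *: 'X - 1) * horadam R m.+1 - horadam R m by [].
have -> : - 2 *: (2 *: 'X - 1) * horadam R m.+1 - horadam R m =
  2 *: horadam R m.+1 - 4 *: ('X * horadam R m.+1) - horadam R m.
  rewrite -!scalerAl mulrBl mul1r -scalerAl scalerBr scalerA !scaleNr opprK.
  rewrite mulNr scaleNr -natrM; congr (_ - _); exact: addrC.
rewrite !(coefZ, coefB, coefXM) (IH k).1 (IH k).2.
case: k => [|k] /=; first by rewrite !addn0 !expr0 !bin1 !natrD -!natr1; ring.
rewrite (IH k).2.
(* With [N = m + k + 2] and [J = 2 * k + 1], what remains is [C(N+2, J+2) = 2 C(N+1, J+2) + C(N, J)
   - C(N, J+2)], which follows from Pascal's rule. *)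
have e3 : (m.+2 + k.+1 + 1 = (m + k.+1 + 1).+2)%N by lia.
have e2 : (m.+1 + k.+1 + 1 = (m + k.+1 + 1).+1)%N by lia.
have e1 : (m.+1 + k + 1 = m + k.+1 + 1)%N by lia.
have ej : (2 * k.+1 + 1 = (2 * k + 1).+2)%N by lia.
rewrite e3 e2 e1 ej !binS.
by rewrite !natrD exprS; ring.
Qed.

Lemma size_horadam (R : realType) (m : nat) : (size (horadam R m) <= m.+1)%N.
Proof.
by apply/leq_sizeP => k mk; rewrite coef_horadam bin_small ?mulr0//; lia.
Qed.

(** The sum over coefficients is reversed so that [p] measures the distance from the leading power,
    the indexing of both target formulas. *)
Lemma horner_derivn_horadam (R : realType) (m r : nat) (x : R) : (r <= m)%N ->
  ((horadam R m)^`(r)).[x] =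
  \sum_(0 <= p < (m - r).+1)
    (- 4) ^+ (m - p) * 'C(m + (m - p) + 1, 2 * (m - p) + 1)%:R
    * ((m - p) ^_ r)%:R * x ^+ (m - p - r).
Proof.
move=> rm; rewrite (@horner_coef_wide _ (m - r).+1); last first.
  apply/leq_sizeP => k mk; rewrite coef_derivn coef_horadam.
  by rewrite bin_small ?mulr0 ?mul0rn//; lia.
rewrite -(big_mkord xpredT (fun i => ((horadam R m)^`(r))`_i * x ^+ i)).
rewrite big_nat_rev /= add0n; apply: eq_big_nat => p /andP[_ pmr].
have -> : ((m - r).+1 - p.+1 = m - p - r)%N by lia.
rewrite coef_derivn coef_horadam (_ : r + (m - p - r) = m - p)%N; last by lia.
by congr (_ * _); rewrite -[LHS]mulr_natr.
Qed.

(** * Rising factorials at negative integers and half-integers *)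

Lemma pochS (R : realType) (a : R) (n : nat) :
  poch a n.+1 = a * poch (a + 1) n.
Proof.
rewrite /poch big_ord_recl addr0; congr (_ * _).
by apply: eq_bigr => i _; rewrite /= /bump /= natrD addrA.
Qed.

Lemma pochD (R : realType) (a : R) (p n : nat) :
  poch a (p + n) = poch a p * poch (a + p%:R) n.
Proof.
elim: p a => [|p IH] a; first by rewrite /poch big_ord0 mul1r addr0.
by rewrite addSn !pochS IH -!addrA nat1r mulrA.
Qed.

(** Up to sign the factors are [n, n - 1, ..., n - p + 1], and [(n - p)!] completes them to [n!].
    This evaluates the denominators [(c)_p] of the series and shows that they are nonzero. *)
Lemma poch_oppn (R : realType) (n p : nat) : (p <= n)%N ->
  poch (- n%:R : R) p * (n - p)`!%:R = (- 1) ^+ p * n`!%:R.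
Proof.
elim: p n => [|p IH] [|n]// pn; first by rewrite /poch big_ord0 expr0 subn0.
  by rewrite /poch big_ord0 expr0 subn0.
rewrite pochS -natr1 opprD subrK subSS -mulrA IH// exprS factS natrM -natr1.
by ring.
Qed.

(** The product of the half-integers from [-1/2 - k] to [-1/2] is [(-1)^(k+1) (2k+1)!! / 2^(k+1)],
    and [(2k+1)! = (2k+1)!! 2^k k!]. *)
Lemma poch_half_integer (R : realType) (k : nat) :
  poch (- (1 / 2) - k%:R : R) k.+1 * (- 2 * (- 4) ^+ k * k`!%:R)
  = (2 * k + 1)`!%:R.
Proof.
elim: k => [|k IH].
  rewrite /poch big_ord_recl big_ord0 /= expr0 muln0 add0n !factS fact0.
  by field.
rewrite pochS (_ : - (1 / 2) - k.+1%:R + 1 = - (1 / 2) - k%:R :> R); last first.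
  by rewrite -natr1; ring.
have -> : (2 * k.+1 + 1 = (2 * k + 1).+2)%N by lia.
by rewrite !factS !natrM -IH exprS -!natr1 natrD natrM; field.
Qed.

(** * Improper integrals over open half-lines and Euler's integral *)

Import numFieldNormedType.Exports.
Local Open Scope classical_set_scope.

(* Unlike [ge0_continuous_FTC2y], f may blow up at a, as t^(-1/2) e^(-t) does
   at 0. *)
Lemma ge0_FTC2_oy (R : realType) (f F : R -> R) (a l L : R) :
  (forall x, a < x -> 0 <= f x) ->
  (forall x, a < x -> {for x, continuous f}) ->
  (forall x, a < x -> is_derive x 1 F (f x)) ->
  F x @[x --> +oo] --> l -> F x @[x --> a^'+] --> L ->
  Rintegral (@lebesgue_measure R) `]a, +oo[ f = l - L.
Proof.
move=> f0 cf dF Fl FL.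
(* The open half-line is exhausted by closed ones starting at [b n], where [f] is continuous up to
   the endpoint; monotone convergence gives the limit. *)
pose b n : R := a + n.+1%:R^-1.
have ab n : a < b n by rewrite ltrDl invr_gt0 ltr0n.
have bS : `]a, +oo[ = \bigcup_n `[b n, +oo[ :> set R.
  apply/seteqP; split => x /=.
    rewrite in_itv/= andbT => ax.
    have xa : 0 < x - a by rewrite subr_gt0.
    have [n _ /(_ n (leqnn n)) nx] := near_infty_natSinv_lt (PosNum xa).
    by exists n => //=; rewrite in_itv/= andbT -lerBrDl ltW.
  by move=> [n _] /=; rewrite !in_itv/= !andbT; apply: lt_le_trans.
have cfb n : {within `[b n, +oo[, continuous f}.
  apply/continuous_within_itvcyP; split.
    by move=> x; rewrite in_itv/= andbT => bx; apply: cf; apply: lt_trans bx.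
  exact/cvg_at_right_filter/cf.
have Ib n : (\int[@lebesgue_measure R]_(x in `[b n, +oo[) (f x)%:E
    = (l - F (b n))%:E)%E.
  rewrite EFinB; apply: ge0_continuous_FTC2y => //.
  - by move=> x bx; apply: f0; apply: lt_le_trans bx.
  - by move=> x bx; case: (dF x (lt_trans (ab n) bx)).
  - apply: cvg_at_right_filter.
    by apply/differentiable_continuous/derivable1_diffP; case: (dF _ (ab n)).
  - move=> x; rewrite in_itv/= andbT => bx.
    have dFx := dF x (lt_trans (ab n) bx).
    by rewrite derive1E; apply: derive_val.
have Fb : F (b n) @[n --> \oo] --> L.
  move/cvg_at_rightP : FL; apply; split => //.
  rewrite -[X in _ --> X]addr0; apply: cvgD; first exact: cvg_cst.
  exact: cvg_harmonic.
rewrite /Rintegral bS.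
have h : (\int[@lebesgue_measure R]_(x in `[b n, +oo[) (f x)%:E @[n --> \oo]
    --> \int[@lebesgue_measure R]_(x in \bigcup_n `[b n, +oo[) (f x)%:E)%E.
  apply: ge0_nondecreasing_set_cvg_integral => //.
  - apply/nondecreasing_seqP => n; apply/subsetPset => x /=.
    rewrite !in_itv/= !andbT; apply: le_trans.
    by rewrite lerD2l lef_pV2 ?posrE ?ler_nat.
  - move=> n; apply/measurable_EFinP.
    exact: subspace_continuous_measurable_fun (cfb n).
  - by move=> n x /=; rewrite in_itv/= andbT lee_fin => bx;
      apply: f0; apply: lt_le_trans bx.
rewrite -(cvg_lim _ h)//; under eq_fun do rewrite Ib.
rewrite (_ : limn _ = (l - L)%:E)//; apply/cvg_lim => //.
by apply: cvg_EFin; [exact: nearW|apply: cvgB => //; exact: cvg_cst].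
Qed.

(** For [x > 0], [x^(n+1) / (n+1)! <= exp x] bounds the function by [(n+1)! / x]. *)
Lemma cvgy_exprn_expRN (R : realType) (n : nat) :
  x ^+ n * expR (- x) @[x --> +oo] --> (0 : R).
Proof.
apply: (@squeeze_cvgr _ _ _ _ (cst 0) (fun x => n.+1`!%:R * x^-1)).
- near=> x.
  have x0 : 0 < x by near: x; exact: nbhs_pinfty_gt (num_real _).
  apply/andP; split; first by rewrite mulr_ge0 ?exprn_ge0 ?expR_ge0 ?(ltW x0).
  rewrite expRN ler_pdivrMr ?expR_gt0// mulrAC ler_pdivlMr// -exprSr.
  rewrite -ler_pdivrMl ?ltr0n ?fact_gt0// mulrC.
  by apply: le_trans (expR_ge1Dxn n (ltW x0)); rewrite lerDr.
- exact: cvg_cst.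
- rewrite -[X in _ --> X](mulr0 n.+1`!%:R); apply: cvgMl_tmp.
  apply: (gtr0_cvgV0 _).2; last exact: cvg_id.
  exact: nbhs_pinfty_gt (num_real _).
Unshelve. all: by end_near. Qed.

Lemma is_derive_expRN (R : realType) (x : R) :
  is_derive x 1 (fun y : R => expR (- y)) (- expR (- x)).
Proof. by apply: is_derive_eq; rewrite ?/GRing.scale /=; ring. Qed.

(** Integration by parts at the level of primitives: [F_(n+1)(x) = (n+1) F_n(x) - x^(n+1) exp(-x)],
    starting from [F_0(x) = - exp(-x)]. *)
Lemma exprn_expRN_primitive (R : realType) (n : nat) :
  exists F : R -> R, [/\ forall x : R, is_derive x 1 F (x ^+ n * expR (- x)),
    F 0 = - n`!%:R & F x @[x --> +oo] --> 0].
Proof.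
elim: n => [|n [F [dF F0 Fy]]].
  exists (fun x => - expR (- x)); split.
  - move=> x; rewrite expr0 mul1r -[X in is_derive _ _ _ X]opprK.
    exact: (is_deriveN (is_derive_expRN x)).
  - by rewrite oppr0 expR0.
  - by rewrite -[X in _ --> X]oppr0; apply: cvgN; exact: cvgr_expR.
exists (fun x => n.+1%:R * F x - x ^+ n.+1 * expR (- x)); split.
- move=> x.
  have dnF := is_deriveZ n.+1%:R (dF x).
  have dX : is_derive x 1 (fun y : R => y ^+ n.+1) (n.+1%:R * x ^+ n).
    split; first exact: exprn_derivable.
    by rewrite -derive1E exp_derive1.
  apply: (is_derive_eq (is_deriveB dnF (is_deriveM dX (is_derive_expRN x)))).
  by rewrite /GRing.scale /= exprS; ring.
- by rewrite F0 expr0n mul0r subr0 mulrN -natrM.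
- rewrite -[X in _ --> X](subr0 0) -[X in X - _](mulr0 n.+1%:R).
  apply: cvgB; first exact: cvgMl_tmp.
  exact: cvgy_exprn_expRN.
Qed.

Lemma euler_gammaS (R : realType) (n : nat) :
  euler_gamma (n%:R + 1 : R) = n`!%:R.
Proof.
have [F [dF F0 Fy]] := @exprn_expRN_primitive R n.
rewrite /euler_gamma addrK.
transitivity (Rintegral (@lebesgue_measure R) `]0, +oo[
    (fun t : R => t ^+ n * expR (- t))).
  by apply: eq_Rintegral => x; rewrite inE/= in_itv/= andbT => /ltW x0;
    rewrite powR_mulrn.
rewrite (@ge0_FTC2_oy _ _ F _ 0 (- n`!%:R)) ?opprK ?add0r//.
- by move=> x x0; rewrite mulr_ge0 ?exprn_ge0 ?expR_ge0// ltW.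
- move=> x _; apply/differentiable_continuous/derivable1_diffP.
  by apply: derivableM; [exact: exprn_derivable|have [] := is_derive_expRN x].
- rewrite -F0; apply: cvg_at_right_filter.
  by apply/differentiable_continuous/derivable1_diffP; case: (dF 0).
Qed.

(** The substitution [t = u^2] is made through a primitive: if [I] is the integral of [exp(-u^2)]
    from 0, then [2 * I (sqrt t)] has derivative [t^(-1/2) exp(-t)] for [t > 0]. *)
Lemma euler_gamma_half (R : realType) : euler_gamma (1 / 2 : R) = Num.sqrt pi.
Proof.
pose I := @gauss_integral_proof.integral0_gauss R.
have gaussI (u : R) :
    (@lebesgue_measure R).-integrable `[0, u] (EFin \o @gauss_fun R).
  apply: integrableS (@integrableT_gauss R) => //.
have dI (x : R) : 0 < x -> is_derive x 1 I (gauss_fun x).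
  move=> x0; have xx1 : x < x + 1 by rewrite ltrDl.
  have cx : {for x, continuous (@gauss_fun R)} by apply: continuous_gauss_fun.
  have [dIx Ix] := continuous_FTC1_closed xx1 (gaussI _) x0 cx.
  by split => //; rewrite -derive1E.
have Iy : I x @[x --> +oo] --> Num.sqrt pi / 2.
  (* The known limit is that of [I ^+ 2], namely [pi / 4]; since [I] is nonnegative, square roots
     may be taken. *)
  have -> : I = (fun x => Num.sqrt (I x ^+ 2)).
    apply/funext => x; rewrite sqrtr_sqr ger0_norm//.
    exact: gauss_integral_proof.integral0_gauss_ge0.
  have -> : Num.sqrt pi / 2 = Num.sqrt (pi / 4 : R).
    by rewrite sqrtrM ?pi_ge0// sqrtrV// (_ : 4 = 2 ^+ 2)
      ?sqrtr_sqr ?ger0_norm// -natrX.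
  apply: continuous_cvg; first exact: sqrt_continuous.
  exact: gauss_integral_proof.cvg_integral0_gauss_sqr.
rewrite /euler_gamma -[RHS]subr0.
apply: (@ge0_FTC2_oy _ _ (fun t => 2 * I (Num.sqrt t))).
- by move=> x x0; rewrite mulr_ge0 ?powR_ge0 ?expR_ge0.
- move=> x x0; apply/differentiable_continuous/derivable1_diffP.
  apply: derivableM; last by have [] := is_derive_expRN x.
  by have [] := is_derive1_powR (1 / 2 - 1) x0.
- move=> x x0; have sx0 : 0 < Num.sqrt x by rewrite sqrtr_gt0.
  have dIs := is_derive1_comp (dI _ sx0) (is_derive1_sqrt x0).
  apply: is_derive_eq.
  rewrite /GRing.scale/= /gauss_fun sqr_sqrtr ?ltW//.
  rewrite (_ : 1 / 2 - 1 = - 2^-1); last by field.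
  rewrite powRN powR12_sqrt ?ltW//; field; exact: lt0r_neq0.
- rewrite [X in _ --> X](_ : _ = 2 * (Num.sqrt pi / 2)); last by field.
  apply: cvgMl_tmp; apply: cvg_comp Iy.
  apply/cvgryPge => A; near=> x.
  apply: le_trans (ler_norm A) _; rewrite -sqrtr_sqr; apply: ler_wsqrtr.
  by near: x; exact: nbhs_pinfty_ge (num_real _).
- rewrite -[X in _ --> X](mulr0 2); apply: cvgMl_tmp.
  have s0 : Num.sqrt x @[x --> 0^'+] --> (0 : R).
    rewrite -[X in _ --> X]sqrtr0; apply: cvg_at_right_filter.
    exact: sqrt_continuous.
  apply: cvg_comp s0 _.
  exact: (parameterized_integral_cvg_left ltr01 (gaussI 1)).
Unshelve. all: by end_near. Qed.

(** * Gamma at positive integers and negative half-integers *)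

Lemma GammaS (R : realType) (n : nat) : Gamma (n%:R + 1 : R) = n`!%:R.
Proof.
rewrite /Gamma natr1 ltr0Sn addr0 /poch big_ord0 divr1 -natr1.
exact: euler_gammaS.
Qed.

(** The truncation of [1/2 + k] is [k], so the definition shifts the argument by [k + 1], which
    lands exactly on [1/2]. *)
Lemma Gamma_oppr_half_sub (R : realType) (k : nat) :
  Gamma (- (1 / 2) - k%:R : R)
  = Num.sqrt pi / poch (- (1 / 2) - k%:R : R) k.+1.
Proof.
have k0 : 0 <= k%:R :> R by [].
rewrite /Gamma ifN; last by rewrite -leNgt; lra.
rewrite (@truncn_def _ _ k); last by rewrite -(natr1 k); apply/andP; split; lra.
by rewrite -(natr1 k) (_ : _ + _ = 1 / 2) ?euler_gamma_half//; field.
Qed.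

(** * Termwise comparison with the Gamma and hypergeometric coefficients *)

Lemma horadam_coef_Gamma (R : realType) (m r p : nat) : (p + r <= m)%N ->
  (- 4) ^+ (m - p) * 'C(m + (m - p) + 1, 2 * (m - p) + 1)%:R
    * ((m - p) ^_ r)%:R
  = - (1 / (2 * Num.sqrt pi)) *
    ((1 + 2 * m - p)`!%:R * Gamma (- (1 / 2) - m%:R + p%:R)
      / (p`!%:R * (m - p - r)`!%:R)) :> R.
Proof.
move=> prm; set k := (m - p)%N.
have fact_neq0 n : n`!%:R != 0 :> R by rewrite pnatr_eq0 -lt0n fact_gt0.
have pi_neq0 : Num.sqrt pi != 0 :> R by rewrite gt_eqF// sqrtr_gt0 pi_gt0.
(* [hP] gives [Gamma(-1/2 - k) = sqrt pi * (-2) (-4)^k k! / (2k+1)!]; the prefactor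
   [-1 / (2 sqrt pi)] then leaves the power [(-4)^k]. *)
have := poch_half_integer R k; set P := poch _ _ => hP.
have P_neq0 : P != 0.
  by apply: contra_eq_neq hP => ->; rewrite mul0r eq_sym.
have -> : - (1 / 2) - m%:R + p%:R = - (1 / 2) - k%:R :> R.
  by rewrite natrB; [ring|lia].
rewrite Gamma_oppr_half_sub -/P.
have -> : (1 + 2 * m - p = m + k + 1)%N by lia.
have hC : 'C(m + k + 1, 2 * k + 1)%:R * (2 * k + 1)`!%:R * p`!%:R
    = (m + k + 1)`!%:R :> R.
  rewrite -!natrM -mulnA -(bin_fact (_ : 2 * k + 1 <= m + k + 1)%N);
    last by lia.
  by have -> : (m + k + 1 - (2 * k + 1) = p)%N by lia.
have hF : (k ^_ r)%:R * (k - r)`!%:R = k`!%:R :> R.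
  by rewrite -natrM ffact_fact//; lia.
rewrite -hC -hP -hF; field.
by rewrite P_neq0 pi_neq0 !fact_neq0.
Qed.

(** With [b = -m - 1/2] and [c = -2m - 1], one has [Gamma(b) (b)_p = Gamma(b + p)] and
    [(c)_p = (-1)^p (2m+1)! / (2m+1-p)!], so the signs cancel. *)
Lemma hyp2F1_coef_Gamma (R : realType) (m r p : nat) : (p + r <= m)%N ->
  Gamma (- m%:R - 1 / 2) * (2 * m + 1)`!%:R / (m - r)`!%:R *
    ((- 1) ^+ p * 'C(m - r, p)%:R *
     (poch (- m%:R - 1 / 2) p / poch (- (2 * m%:R) - 1) p))
  = (1 + 2 * m - p)`!%:R * Gamma (- (1 / 2) - m%:R + p%:R)
      / (p`!%:R * (m - p - r)`!%:R) :> R.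
Proof.
move=> prm.
have fact_neq0 n : n`!%:R != 0 :> R by rewrite pnatr_eq0 -lt0n fact_gt0.
have -> : - m%:R - 1 / 2 = - (1 / 2) - m%:R :> R by ring.
have ek : - (1 / 2) - m%:R + p%:R = - (1 / 2) - (m - p)%:R :> R.
  by rewrite natrB; [ring|lia].
rewrite ek !Gamma_oppr_half_sub.
(* Splitting the product of [m + 1] factors after the first [p] relates the two Gamma values. *)
have := pochD (- (1 / 2) - m%:R : R) p (m - p).+1.
rewrite ek (_ : p + (m - p).+1 = m.+1)%N; last by lia.
move=> hD; rewrite hD.
have := poch_half_integer R m; rewrite hD => hP.
have : poch (- (1 / 2) - m%:R : R) p *
    poch (- (1 / 2) - (m - p)%:R : R) (m - p).+1 != 0.
  by apply: contra_eq_neq hP => ->; rewrite mul0r eq_sym.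
rewrite mulf_eq0 negb_or => /andP[P1 P2].
have -> : - (2 * m%:R) - 1 = - (2 * m + 1)%:R :> R.
  by rewrite natrD natrM; ring.
have hc : poch (- (2 * m + 1)%:R : R) p * (1 + 2 * m - p)`!%:R
    = (- 1) ^+ p * (2 * m + 1)`!%:R.
  by rewrite addnC poch_oppn//; lia.
have c_neq0 : poch (- (2 * m + 1)%:R : R) p != 0.
  apply: contra_eq_neq hc => ->.
  by rewrite mul0r eq_sym mulf_neq0// signr_eq0.
have hC : 'C(m - r, p)%:R * p`!%:R * (m - p - r)`!%:R = (m - r)`!%:R :> R.
  rewrite -!natrM -mulnA -(bin_fact (_ : p <= m - r)%N); last by lia.
  by have -> : (m - r - p = m - p - r)%N by lia.
have C_neq0 : 'C(m - r, p)%:R != 0 :> R.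
  by rewrite pnatr_eq0 -lt0n bin_gt0; lia.
have -> : (1 + 2 * m - p)`!%:R
    = (- 1) ^+ p * (2 * m + 1)`!%:R / poch (- (2 * m + 1)%:R : R) p.
  by rewrite -hc; field.
rewrite -hC; field.
by rewrite P1 P2 C_neq0 c_neq0 !fact_neq0.
Qed.

Theorem proposition2p1 (R : realType) (m r : nat)
    (hm : (1 <= m)%N) (hr : (1 <= r)%N) (hrm : (r <= m)%N) :
  (forall x : R,
     ((horadam R m)^`(r)).[x] =
     - (1 / (2 * Num.sqrt pi)) *
       \sum_(0 <= p < (m - r).+1)
         ((1 + 2 * m - p)`!%:R * Gamma (- (1 / 2) - m%:R + p%:R)
            * (m - p)`!%:R)
         / ((m - p)`!%:R * p`!%:R * (m - p - r)`!%:R)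
         * x ^+ (m - p - r))
  /\
  (forall x : R, x != 0 ->
     ((horadam R m)^`(r)).[x] =
     - (Gamma (- m%:R - 1 / 2) * Gamma (2 * m%:R + 2)
          / (2 * Num.sqrt pi * Gamma ((m%:R : R) - r%:R + 1)))
       * hyp2F1_term (- m%:R - 1 / 2) (m - r) (- (2 * m%:R) - 1) (1 / x)
       * x ^+ (m - r)).
Proof.
have fact_neq0 n : n`!%:R != 0 :> R by rewrite pnatr_eq0 -lt0n fact_gt0.
have pi_neq0 : Num.sqrt pi != 0 :> R by rewrite gt_eqF// sqrtr_gt0 pi_gt0.
split=> [x|x x0].
  rewrite horner_derivn_horadam// big_distrr.
  apply: eq_big_nat => p /andP[_ pr] /=.
  rewrite horadam_coef_Gamma; last by lia.
  by field; rewrite !fact_neq0 pi_neq0.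
have -> : 2 * m%:R + 2 = (2 * m + 1)%:R + 1 :> R by rewrite natrD natrM; ring.
rewrite -natrB// !GammaS horner_derivn_horadam// /hyp2F1_term.
rewrite -mulrA mulr_suml mulr_sumr; apply: eq_big_nat => p /andP[_ pr].
rewrite horadam_coef_Gamma -?hyp2F1_coef_Gamma; [|lia..].
(* Since [x] is nonzero, descending powers of [x] become powers of [1 / x] times the leading
   power. *)
have -> : x ^+ (m - p - r) = (1 / x) ^+ p * x ^+ (m - r).
  rewrite (_ : m - r = p + (m - p - r))%N; last by lia.
  by rewrite exprD div1r exprVn mulKf// expf_neq0.
(* Treating the series coefficient as an atom spares [field] a side condition on its denominator. *)
set c := _ * (_ / poch _ _).
by field; rewrite !fact_neq0 pi_neq0.
Qed.
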